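(* There exist absolute constants $c_1,c_2,c_3>0$ such that the following holds. Let $T\subset\mathbb{R}^n$, let $A:\mathbb{R}^n\to\mathbb{R}^m$ be a (deterministic) matrix, let $\lambda,\delta,\kappa>0$ and $0<\theta\leq\delta$, and let $T_\theta\subset T$ be a minimal $\theta$-net of $T$, so that $|T_\theta|=\mathcal N(T,\theta)$. Put $s=\lfloor\delta m/\lambda\rfloor$. Let $$m\geq c_1\lambda^2\kappa^2\,\frac{\log\mathcal N(T,\theta)}{\delta^2},$$ and assume that $$\sup_{x,y\in T_\theta}\left|\frac{\kappa}{m}\|A(x-y)\|_1-\|x-y\|_2\right|\leq\delta,$$ $$\frac1{\sqrt s}\sup_{x\in T_\theta}\|Ax\|_{[s]}\leq\lambda,\qquad\text{and}\qquad\frac1{\sqrt s}\sup_{x\in(T-T)\cap\theta B_2^n}\|Ax\|_{[s]}\leq\delta.$$ Let $\tau$ be uniformly distributed in $[-\lambda,\lambda]^m$ and let $f(x)=\operatorname{sign}(Ax+\tau)$. Then with probability at least $1-2\exp(-c_2\delta^2m/(\lambda^2\kappa^2))$ with respect to $\tau$, $$\sup_{x,y\in T}\left|\tilde d(f(x),f(y))-\|x-y\|_2\right|\leq c_3(\kappa+1)\delta,$$ where $\tilde d(u,v)=\frac{2\lambda\kappa}{m}d_H(u,v)$ for $u,v\in\{-1,1\}^m$.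
   Context: $B_2^n$ is the Euclidean unit ball and $T-T=\{t_1-t_2:t_1,t_2\in T\}$. $\mathcal N(T,\theta)$ is the smallest number of open Euclidean balls of radius $\theta$ needed to cover $T$; a $\theta$-net $T_\theta\subset T$ has the property that every $x\in T$ has a point $\pi x\in T_\theta$ with $\|x-\pi x\|_2\leq\theta$. For $v\in\mathbb{R}^m$ and an integer $1\leq s\leq m$, $\|v\|_{[s]}=\max_{|I|=s}\left(\sum_{i\in I}v_i^2\right)^{1/2}$, the maximum being over $I\subset\{1,\dots,m\}$; the use of $\|\cdot\|_{[s]}$ presupposes $1\leq s\leq m$. The function $\operatorname{sign}$ is applied coordinatewise, with $\operatorname{sign}(a)=1$ if $a\geq0$ and $-1$ if $a<0$. $d_H$ is the Hamming distance on $\{-1,1\}^m$ (number of differing coordinates). ''Absolute constant'' means a positive number independent of all other parameters. *)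

(* Defs.v *)
From HB Require Import structures.
From mathcomp Require Import all_boot all_order all_algebra finmap.
From mathcomp Require Import all_classical all_reals all_analysis.

Set Implicit Arguments.
Unset Strict Implicit.
Unset Printing Implicit Defensive.

Import Order.TTheory GRing.Theory Num.Theory.
Local Open Scope classical_set_scope.
Local Open Scope ring_scope.

Section Geometry.
Context {R : realType}.

(* The library norm [`|v|] on matrices is the sup norm, hence these two. *)
Definition l1norm {k} (v : 'cV[R]_k) : R := \sum_i `|v i 0|.

Definition l2norm {k} (v : 'cV[R]_k) : R := Num.sqrt (\sum_i v i 0 ^+ 2).

Definition unit_ball {k} : set 'cV[R]_k := [set x | l2norm x <= 1].

Definition open_ball {k} (x : 'cV[R]_k) (r : R) : set 'cV[R]_k :=
  [set y | l2norm (y - x) < r].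

(* The index sets range over the s-element subsets of {0, .., m-1}; when
   s <= m there is at least one, and the default 0 of the maximum is
   irrelevant because the terms are nonnegative. *)
Definition topnorm (s : nat) {m} (v : 'cV[R]_m) : R :=
  \big[Num.max/0]_(I : {set 'I_m} | #|I| == s)
     Num.sqrt (\sum_(i in I) v i 0 ^+ 2).

(* Extended-real valued: +oo when no finite cover exists.  The centres are
   arbitrary points of the ambient space. *)
Definition covering_number {k} (T : set 'cV[R]_k) (r : R) : \bar R :=
  ereal_inf [set (N%:R)%:E | N in
    [set N : nat | exists c : 'I_N -> 'cV[R]_k,
                     T `<=` \bigcup_(i in [set: 'I_N]) open_ball (c i) r]].

Definition is_net {k} (T : set 'cV[R]_k) (r : R) (S : {fset 'cV[R]_k}) : Prop :=
  [set` S] `<=` T /\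
  forall x, T x -> exists2 y, y \in S & l2norm (x - y) <= r.

(* Minimality is in the sense that the net has exactly N(T, r) points. *)
Definition minimal_net {k} (T : set 'cV[R]_k) (r : R) (S : {fset 'cV[R]_k}) :
    Prop :=
  is_net T r S /\ (#|` S|%:R)%:E = covering_number T r.

Definition diffset {k} (T : set 'cV[R]_k) : set 'cV[R]_k :=
  [set x - y | x in T & y in T].

(* Unlike [Num.sg], the value at 0 is 1. *)
Definition sign (a : R) : R := if 0 <= a then 1 else -1.

(* One-bit quantisation x |-> sign(Ax + t), with {-1, 1}^m inside R^m. *)
Definition onebit {m n} (A : 'M[R]_(m, n)) (t : 'cV[R]_m) (x : 'cV[R]_n) :
    'cV[R]_m :=
  map_mx sign (A *m x + t).

Definition hamming {m} (u v : 'cV[R]_m) : nat := #|[set i | u i 0 != v i 0]|.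

Definition dtilde (lambda kappa : R) {m} (u v : 'cV[R]_m) : R :=
  2 * lambda * kappa / m%:R * (hamming u v)%:R.

End Geometry.

Section Probability.
Context {R : realType} {d : measure_display} {Omega : measurableType d}.
Variable P : probability Omega R.

(* The law of (tau_0, .., tau_(m-1)) is normalised Lebesgue measure on
   [-lambda, lambda]^m; it is given by its values on measurable boxes, which
   determine it. *)
Definition uniform_on_cube {m} (lambda : R) (lambda_gt0 : 0 < lambda)
    (tau : 'I_m -> {RV P >-> R}) : Prop :=
  forall B : 'I_m -> set R, (forall i, measurable (B i)) ->
    P [set w | forall i, B i (tau i w)] =
    (\prod_(i < m) uniform_prob (gtrN lambda_gt0) (B i))%E.

(* An event defined by an uncountable supremum need not be measurable, and a
   [probability] has no prescribed value on non-measurable sets. *)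
Definition with_probability_at_least (p : R) (Q : set Omega) : Prop :=
  exists E : set Omega, [/\ measurable E, E `<=` Q & (p%:E <= P E)%E].

End Probability.

(* Main.v *)
(** Write a = Ax, b = Ay for x, y in the net.  The i-th signs of f(x) and f(y)
    differ iff tau_i falls in an interval of length |a_i - b_i|, which has
    probability |a_i - b_i| / (2 lambda) up to the part of a_i and b_i outside
    [-lambda, lambda]; the bound on [s]-norms makes the total excess at most
    2 s lambda <= 2 delta m.  Hence the expectation of d~(f(x), f(y)) is within
    2 kappa delta of (kappa / m) |A(x - y)|_1, and Hoeffding's inequality with a
    union bound over pairs of net points gives the claim on the net.
    For x in T with nearest net point y, at most s coordinates of A(x - y) exceed
    delta; at the others a sign can flip only if |(Ay)_i + tau_i| <= delta, an
    event of probability at most delta / lambda, again controlled by Hoeffding.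
    So d~(f(x), f(y)) <= (4 kappa + 1) delta, and the triangle inequality for the
    Hamming distance concludes. *)

Require Import Defs.
From HB Require Import structures.
From mathcomp Require Import all_boot all_order all_algebra finmap.
From mathcomp Require Import all_classical all_reals all_analysis.
From mathcomp Require Import ring lra.

Set Implicit Arguments.
Unset Strict Implicit.
Unset Printing Implicit Defensive.

Import Order.TTheory GRing.Theory Num.Theory.
Local Open Scope classical_set_scope.
Local Open Scope ring_scope.

(** * Concentration of the number of hits *)

Section Exponential.
Context {R : realType}.
Implicit Types p t : R.

(** Squaring [1 - t/2 <= expR (- t/2)] gives [half]; it then suffices that the quadratic times
    [(1 - t/2)^2] is at least 1. *)
Lemma expR_le_quadratic t : t <= 1 -> expR t <= 1 + t + 2 * t ^+ 2.
Proof.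
move=> t1.
have half : (1 - t / 2) ^+ 2 * expR t <= 1.
  have -> : expR t = expR (t / 2) ^+ 2.
    by rewrite -expRM_natr; congr expR; lra.
  rewrite -exprMn -[leRHS](expr1n _ 2%N) lerXn2r ?nnegrE ?mulr_ge0 ?expR_ge0//.
    by lra.
  rewrite -[expR _]invrK -expRN ler_pdivrMr ?expR_gt0// mul1r.
  by have := @expR_ge1Dx R (- (t / 2)); lra.
have pos : 0 < (1 - t / 2) ^+ 2 by rewrite exprn_gt0//; lra.
rewrite -(ler_pM2l pos); apply: (le_trans half).
(* Both [1 - t] and [5/4 - t/2] are nonnegative because [t <= 1]. *)
have -> : (1 - t / 2) ^+ 2 * (1 + t + 2 * t ^+ 2) =
    1 + t ^+ 2 * ((1 - t) * (5 / 4 - t / 2)) by field.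
by rewrite lerDl mulr_ge0 ?sqr_ge0// mulr_ge0; lra.
Qed.

(** The linear term averages to zero for a centred variable, which leaves a Gaussian bound on its
    exponential moment. Beyond [t = 1], the exponent [2 t^2] already dominates [t]. *)
Lemma expR_le_sub_gaussian t : expR t <= t + expR (2 * t ^+ 2).
Proof.
have [t1|t1] := leP t 1.
  apply: (le_trans (expR_le_quadratic t1)).
  by have := @expR_ge1Dx R (2 * t ^+ 2); lra.
rewrite (@le_trans _ _ (expR (2 * t ^+ 2)))// ?ler_expR; nra.
Qed.

(** After centring, the values are [- p t] and [(1 - p) t] with weights [1 - p] and [p]: the linear
    terms of [expR_le_sub_gaussian] cancel, and both squares are at most [t^2]. *)
Lemma bernoulli_mgf_le p t : 0 <= p <= 1 ->
  1 - p + p * expR t <= expR (p * t + 2 * t ^+ 2).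
Proof.
move=> /andP[p0 p1].
have ->: 1 - p + p * expR t =
    expR (p * t) * ((1 - p) * expR (- (p * t)) + p * expR ((1 - p) * t)).
  rewrite mulrDr !(mulrCA (expR (p * t))) -!expRD subrr expR0 mulr1.
  by congr (_ + p * expR _); ring.
rewrite expRD ler_wpM2l ?expR_ge0//.
have Q q : 0 <= q <= 1 -> expR (2 * (q * t) ^+ 2) <= expR (2 * t ^+ 2).
  move=> /andP[q0 q1]; rewrite ler_expR exprMn ler_wpM2l//.
  by rewrite ler_piMl ?sqr_ge0// expr_le1.
have Qp := Q p; have Qq := Q (1 - p).
have Ep := expR_le_sub_gaussian (- (p * t)); rewrite sqrrN in Ep.
have Eq := expR_le_sub_gaussian ((1 - p) * t).
have Fp : (1 - p) * expR (- (p * t)) <=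
    (1 - p) * (- (p * t) + expR (2 * t ^+ 2)).
  rewrite ler_wpM2l ?subr_ge0//; apply: (le_trans Ep); rewrite lerD2l Qp//.
  exact/andP.
have Fq : p * expR ((1 - p) * t) <= p * ((1 - p) * t + expR (2 * t ^+ 2)).
  rewrite ler_wpM2l//; apply: (le_trans Eq); rewrite lerD2l Qq//.
  by apply/andP; split; lra.
by lra.
Qed.

End Exponential.

(** One notion of count serves sign changes, sign agreements and coordinates near a threshold
    alike. *)
Definition hits {R : realType} {m} (B : 'I_m -> set R) (t : 'I_m -> R) : nat :=
  #|[set i | B i (t i)]|.

(** * Chernoff bound for the number of independent events that occur *)

Section Hoeffding.
Context {R : realType} {d : measure_display} {Omega : measurableType d}.
Variable P : probability Omega R.

Lemma measurable_bigcup_fin (I : finType) (Q : {pred I}) (F : I -> set Omega) :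
  (forall i, measurable (F i)) -> measurable (\bigcup_(i in [set` Q]) F i).
Proof. by move=> mF; apply: fin_bigcup_measurable => // i _; exact: mF. Qed.

Lemma prob_bigcup_fin_le (I : finType) (Q : {pred I}) (F : I -> set Omega) :
  (forall i, measurable (F i)) ->
  (P (\bigcup_(i in [set` Q]) F i) <= \sum_(i in Q) P (F i))%E.
Proof.
move=> mF; rewrite bigcup_pred.
suff [] : measurable (\big[setU/set0]_(i in Q) F i) /\
  (P (\big[setU/set0]_(i in Q) F i) <= \sum_(i in Q) P (F i))%E by [].
elim/big_rec2 : _ => [|i y A _ [mA PA]]; first by rewrite measure0.
split; first exact: measurableU.
by apply: (le_trans (measureU2 _ _ _)) => //; rewrite leeD2l.
Qed.

Definition box {m} (X : 'I_m -> Omega -> R) (B : 'I_m -> set R) : set Omega :=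
  [set w | forall i, B i (X i w)].

Lemma measurable_box {m} (X : 'I_m -> {RV P >-> R}) (B : 'I_m -> set R) :
  (forall i, measurable (B i)) -> measurable (box X B).
Proof.
move=> mB.
have -> : box X B = \bigcap_(i in [set: 'I_m]) (X i @^-1` B i).
  by apply/seteqP; split => [w XB i _ //|w XB i]; apply: XB.
apply: fin_bigcap_measurable => // i _; rewrite -[_ @^-1` _]setTI.
exact: (measurable_funP (X i)).
Qed.

(** With these sides, a box is the event that the set of indices hit is exactly [J]. Events about
    the count thus become finite disjoint unions of boxes, whose probabilities are products. *)
Let side {m} (B : 'I_m -> set R) (J : {set 'I_m}) (i : 'I_m) :=
  if i \in J then B i else ~` B i.

Let measurable_side {m} (B : 'I_m -> set R) J i :
  (forall i, measurable (B i)) -> measurable (side B J i).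
Proof. by move=> mB; rewrite /side; case: ifP => // _; exact: measurableC. Qed.

Let atleast {m} (a : R) : {pred {set 'I_m}} := fun J => a <= #|J|%:R.

Let hits_geE {m} (X : 'I_m -> Omega -> R) (B : 'I_m -> set R) (a : R) :
  [set w | a <= (hits B (X^~ w))%:R] =
  \bigcup_(J in [set` @atleast m a]) box X (side B J).
Proof.
apply/seteqP; split => w /=.
  move=> aw; exists [set i in ([set i | B i (X i w)])%classic]%SET.
    by rewrite /= unfold_in /atleast cardsE.
  by move=> i; rewrite /side inE; case: ifPn => [/set_mem //|/negP h XB];
    apply: h; exact: mem_set.
move=> [J /=]; rewrite unfold_in => aJ boxJ; suff -> : hits B (X^~ w) = #|J| by [].
apply: eq_card => i; have := boxJ i; rewrite /side.
by case: (i \in J) => h; [exact: mem_set|exact: memNset].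
Qed.

Lemma measurable_hits_ge {m} (X : 'I_m -> {RV P >-> R}) (B : 'I_m -> set R)
    (a : R) :
  (forall i, measurable (B i)) -> measurable [set w | a <= (hits B (X^~ w))%:R].
Proof.
move=> mB; rewrite hits_geE; apply: measurable_bigcup_fin => J.
by apply: measurable_box => i; exact: measurable_side.
Qed.

Variable mu : probability (measurableTypeR R) R.

Lemma fine_prob01 (A : set R) : measurable A -> 0 <= fine (mu A) <= 1.
Proof.
move=> mA; have fA : mu A \is a fin_num by exact: fin_num_measure.
rewrite fine_ge0 //=; rewrite -lee_fin fineK//.
exact: probability_le1.
Qed.

Lemma fine_prob_setC (A : set R) : measurable A ->
  fine (mu (~` A)) = 1 - fine (mu A).
Proof.
move=> mA; have fA : mu A \is a fin_num by exact: fin_num_measure.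
by rewrite probability_setC// -[in LHS](fineK fA).
Qed.

(* Chernoff's method, with the exponential moment of the count expanded as a
   sum over the set of indices that are hit. *)
Lemma hoeffding_hits {m} (X : 'I_m -> {RV P >-> R}) (B : 'I_m -> set R) (u : R) :
  (forall C : 'I_m -> set R, (forall i, measurable (C i)) ->
     P (box X C) = (\prod_(i < m) mu (C i))%E) ->
  (forall i, measurable (B i)) -> 0 <= u ->
  (P [set w | (\sum_i fine (mu (B i)) + m%:R * u <= (hits B (X^~ w))%:R)%R]
   <= (expR (- (m%:R * u ^+ 2 / 8)))%:E)%E.
Proof.
move=> indep mB u0; set p := fun i => fine (mu (B i)).
rewrite hits_geE; set a := _ + _.
have mS J i : measurable (side B J i) by exact: measurable_side.
apply: (le_trans (prob_bigcup_fin_le _ _)).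
  by move=> J; exact: measurable_box.
have PJ (J : {set 'I_m}) : P (box X (side B J)) =
    (\prod_i (if i \in J then p i else 1 - p i))%:E.
  rewrite indep// -prodEFin; apply: eq_bigr => i _; rewrite /side.
  have fB : mu (B i) \is a fin_num by apply: fin_num_measure; exact: mB.
  case: ifP => _; first by rewrite /p fineK.
  by rewrite /p probability_setC; [rewrite -[in LHS](fineK fB)|exact: mB].
rewrite (eq_bigr _ (fun J _ => PJ J)) sumEFin lee_fin.
(* The minimiser of the final exponent [m (2 t^2 - t u)], whose value there is [- m u^2 / 8]. *)
set t := u / 4; have t0 : 0 <= t by rewrite divr_ge0.
have p01 i : 0 <= p i <= 1 by exact: fine_prob01.
have PJ0 (J : {set 'I_m}) : 0 <= \prod_i (if i \in J then p i else 1 - p i).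
  by apply: prodr_ge0 => i _; have /andP[? ?] := p01 i; case: ifP => _; lra.
(* The factor [expR (t (|J| - a))] is at least 1 when [a <= |J|]; the other sets only add
   nonnegative terms. *)
apply: (@le_trans _ _ (\sum_(J in {set 'I_m}) expR (- (t * a)) *
    \prod_i (if i \in J then p i * expR t else 1 - p i))).
  rewrite big_mkcond/=; apply: ler_sum => J _.
  have -> : \prod_i (if i \in J then p i * expR t else 1 - p i) =
      \prod_i (if i \in J then p i else 1 - p i) * expR (t * #|J|%:R).
    rewrite expRM_natr -prodr_const [X in _ * X]big_mkcond/=.
    rewrite -big_split/=; apply: eq_bigr => i _.
    by case: ifP => _; rewrite ?mulr1.
  rewrite mulrCA -expRD; case: ifPn => [|_]; last first.
    by rewrite mulr_ge0 ?expR_ge0 ?PJ0.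
  rewrite unfold_in => aJ; rewrite ler_peMr ?PJ0// -[leLHS]expR0 ler_expR.
  by rewrite addrC -mulrBr mulr_ge0// subr_ge0.
(* Distributivity turns the sum over all [J] into the product of the one-coordinate moments. *)
rewrite -mulr_sumr -bigA_distr.
apply: (@le_trans _ _ (expR (- (t * a)) *
    \prod_(i < m) expR (p i * t + 2 * t ^+ 2))).
  rewrite ler_wpM2l ?expR_ge0// ler_prod// => i _; have /andP[? ?] := p01 i.
  rewrite addr_ge0 ?mulr_ge0 ?expR_ge0//=; last lra.
  by rewrite addrC bernoulli_mgf_le.
rewrite -expR_sum -expRD ler_expR big_split/= -mulr_suml sumr_const card_ord.
by rewrite -mulr_natl /a /t; lra.
Qed.

End Hoeffding.

(** * The uniform law on [-lambda, lambda] *)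

Section UniformMeasure.
Context {R : realType}.
Implicit Types a b l x y : R.

Lemma uniform_probE a b (ab : a < b) (B : set R) : measurable B ->
  uniform_prob ab B =
  (((b - a)^-1)%:E * (@lebesgue_measure R) (B `&` `[a, b]))%E.
Proof.
move=> mB; rewrite /uniform_prob integral_uniform_pdf.
rewrite (eq_integral (fun=> ((b - a)^-1)%:E)) ?integral_cst//.
  exact: measurableI.
by move=> x; rewrite inE => -[_ /=]; rewrite in_itv/= /uniform_pdf => ->.
Qed.

Lemma uniform_prob_le l (l0 : 0 < l) (B : set R) x y : measurable B ->
  x <= y -> B `<=` `[x, y] ->
  2 * l * fine (uniform_prob (gtrN l0) B) <= y - x.
Proof.
move=> mB xy Bxy; have fB : uniform_prob (gtrN l0) B \is a fin_num.
  exact: fin_num_measure.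
rewrite -lee_fin EFinM fineK// uniform_probE// muleA -EFinM.
rewrite (_ : 2 * l * _ = 1); last by field; lra.
rewrite mul1e; apply: (@le_trans _ _ (lebesgue_measure `[x, y])).
  apply: le_measure; rewrite ?inE//; first exact: measurableI.
  by move=> z [/Bxy].
by rewrite lebesgue_measure_itv/= lte_fin; case: ifPn => // _; rewrite lee_fin subr_ge0.
Qed.

Lemma uniform_prob_ge l (l0 : 0 < l) (B : set R) x y : measurable B ->
  - l <= x -> y <= l -> `[x, y[ `<=` B ->
  y - x <= 2 * l * fine (uniform_prob (gtrN l0) B).
Proof.
move=> mB lx yl xyB; have fB : uniform_prob (gtrN l0) B \is a fin_num.
  exact: fin_num_measure.
rewrite -lee_fin EFinM fineK// uniform_probE// muleA -EFinM.
rewrite (_ : 2 * l * _ = 1); last by field; lra.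
rewrite mul1e; apply: (@le_trans _ _ (lebesgue_measure `[x, y[)).
  rewrite lebesgue_measure_itv/= lte_fin; case: ifPn => // xy.
  by rewrite lee_fin; lra.
apply: le_measure; rewrite ?inE//; first exact: measurableI.
move=> z xyz; split; first exact: xyB.
by move: xyz; rewrite /= !in_itv/= => /andP[? ?]; apply/andP; split; lra.
Qed.

Definition crossing a b : set R := [set t | sign (a + t) != sign (b + t)].

Definition window a r : set R := [set t | `|a + t| <= r].

(** As a function of [t], [sign (a + t)] jumps at [- a], where it already equals 1; hence the
    interval is closed on the left and open on the right. *)
Lemma crossingE a b : crossing a b = `[- Num.max a b, - Num.min a b[%classic.
Proof.
apply/seteqP; split => t; rewrite /crossing /= in_itv/= /sign.
  rewrite lerNl ltrNr le_max gt_min.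
  have [h|h] := leP 0 (a + t); have [k|k] := leP 0 (b + t); rewrite ?eqxx//.
    by move=> _; apply/andP; split; apply/orP; [left|right]; lra.
  by move=> _; apply/andP; split; apply/orP; [right|left]; lra.
rewrite lerNl ltrNr le_max gt_min => /andP[/orP h /orP k].
have ne : 1 != -1 :> R by apply/eqP; lra.
have [h'|h'] := leP 0 (a + t); have [k'|k'] := leP 0 (b + t) => //;
  rewrite 1?eq_sym//; exfalso; case: h => ?; case: k => ?; lra.
Qed.

Lemma windowE a r : window a r = `[- a - r, - a + r]%classic.
Proof.
apply/seteqP; split => t; rewrite /window /= in_itv/= ler_norml => /andP[? ?];
  apply/andP; split; lra.
Qed.

(** Zero lies between [a + t] and [b + t], so neither is further from it than their distance. *)
Lemma crossing_window a b r t :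
  crossing a b t -> `|a - b| <= r -> window b r t.
Proof.
rewrite /crossing /window /= /sign !ler_norml => + /andP[? ?].
by case: (leP 0 (a + t)) => ?; case: (leP 0 (b + t)) => ?; rewrite ?eqxx// => _;
  apply/andP; split; lra.
Qed.

Lemma measurable_crossing a b : measurable (crossing a b).
Proof. by rewrite crossingE. Qed.

Lemma measurable_window a r : measurable (window a r).
Proof. by rewrite windowE. Qed.

Lemma window_prob_le l (l0 : 0 < l) a r : 0 <= r ->
  l * fine (uniform_prob (gtrN l0) (window a r)) <= r.
Proof.
move=> r0.
have := @uniform_prob_le l l0 (window a r) (- a - r) (- a + r).
move=> /(_ (measurable_window a r)) H.
have: 2 * l * fine (uniform_prob (gtrN l0) (window a r)) <= - a + r - (- a - r).
  by apply: H; [lra|rewrite windowE].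
lra.
Qed.

(** For [l >= 0], the distance from [a] to the interval [[-l, l]]. *)
Definition excess l a : R := Num.max (`|a| - l) 0.

(* When [|a|, |b| <= l] the crossing probability is exactly [|a - b| / 2l]. *)
Lemma crossing_prob l (l0 : 0 < l) a b :
  `|2 * l * fine (uniform_prob (gtrN l0) (crossing a b)) - `|a - b| |
  <= excess l a + excess l b.
Proof.
have mC := measurable_crossing a b.
set q := 2 * l * _.
have e0 c : 0 <= excess l c by rewrite /excess le_max lexx orbT.
have ee c : `|c| - l <= excess l c by rewrite /excess le_max lexx.
have maxmin : Num.max a b - Num.min a b = `|a - b|.
  by case: (leP a b) => ab; [rewrite distrC|]; rewrite ger0_norm//; lra.
have up : q <= `|a - b|.
  rewrite -maxmin; have -> : Num.max a b - Num.min a b = - Num.min a b - - Num.max a b by ring.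
  apply: uniform_prob_le => //.
    by rewrite lerN2 ge_min le_max lexx.
  rewrite crossingE => t; rewrite /= !in_itv/= => /andP[-> /ltW].
  by move=> ->.
have lo : `|a - b| - excess l a - excess l b <= q.
  (* Projection onto [[-l, l]], which moves a point by at most its excess. The half-open interval
     between the clamped endpoints stays inside the crossing set and is shorter by at most the two
     excesses. *)
  pose clamp c := Num.max (- l) (Num.min l c).
  have cle c : - l <= clamp c by rewrite /clamp le_max lexx.
  have cge c : clamp c <= l by rewrite /clamp ge_max ge_min lexx/= andbT; lra.
  have clo c : c - excess l c <= clamp c.
    have := ee c; have := e0 c; have := ler_norm c => ? ? ?.
    rewrite /clamp le_max le_min; apply/orP.
    by have [?|?] := leP (c - excess l c) (- l); [left|right; apply/andP; split; lra].
  have chi c : clamp c <= c + excess l c.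
    have := ee c; have := e0 c; have := ler_norm (- c); rewrite normrN => ? ? ?.
    rewrite /clamp ge_max ge_min; apply/andP; split; first lra.
    by apply/orP; right; lra.
  have exN c : excess l (- c) = excess l c by rewrite /excess normrN.
  apply: (@le_trans _ _ (clamp (- Num.min a b) - clamp (- Num.max a b))).
    have := clo (- Num.min a b); have := chi (- Num.max a b); rewrite !exN -maxmin.
    by case: (leP a b) => ab; lra.
  apply: uniform_prob_ge => // t; rewrite crossingE /= !in_itv/= => /andP[].
  rewrite {1}/clamp ge_max ge_min => /andP[lt /orP t1].
  rewrite {1}/clamp lt_max lt_min => /orP t2.
  apply/andP; split.
    case: t1 => // t1; exfalso; case: t2 => [|/andP[? ?]]; lra.
  case: t2 => [|/andP[? ?]]; lra.
have := e0 a; have := e0 b.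
by rewrite ler_norml => ? ?; apply/andP; split; lra.
Qed.

End UniformMeasure.

(** * Euclidean and [s]-norms *)

Section Norms.
Context {R : realType}.

Lemma l2norm_ge0 k (v : 'cV[R]_k) : 0 <= l2norm v.
Proof. exact: sqrtr_ge0. Qed.

Lemma l2normZ k (c : R) (v : 'cV[R]_k) : l2norm (c *: v) = `|c| * l2norm v.
Proof.
rewrite /l2norm (eq_bigr (fun i => c ^+ 2 * v i 0 ^+ 2)); last first.
  by move=> i _; rewrite mxE exprMn.
by rewrite -mulr_sumr sqrtrM ?sqr_ge0// sqrtr_sqr.
Qed.

Lemma l2normN k (v : 'cV[R]_k) : l2norm (- v) = l2norm v.
Proof. by rewrite -scaleN1r l2normZ normrN1 mul1r. Qed.

(** Cauchy-Schwarz: [quad] expresses that the sum of the squares [(x u_i - y v_i)^2] is nonnegative,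
    and [x], [y] are then chosen. *)
Lemma sum_mul_le_l2norm k (u v : 'cV[R]_k) :
  \sum_i u i 0 * v i 0 <= l2norm u * l2norm v.
Proof.
set a := \sum_i u i 0 ^+ 2; set b := \sum_i v i 0 ^+ 2.
set c := \sum_i _.
have a0 : 0 <= a by apply: sumr_ge0 => i _; exact: sqr_ge0.
have b0 : 0 <= b by apply: sumr_ge0 => i _; exact: sqr_ge0.
have quad (x y : R) : 2 * x * y * c <= x ^+ 2 * a + y ^+ 2 * b.
  rewrite /a /b /c !mulr_sumr -big_split/=; apply: ler_sum => i _.
  have -> : x ^+ 2 * u i 0 ^+ 2 + y ^+ 2 * v i 0 ^+ 2 =
      2 * x * y * (u i 0 * v i 0) + (x * u i 0 - y * v i 0) ^+ 2 by ring.
  by rewrite lerDl sqr_ge0.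
have [c0|c0] := leP c 0; first by rewrite (le_trans c0)// mulr_ge0 ?l2norm_ge0.
have b_gt0 : 0 < b.
  rewrite lt_def b0 andbT; apply/eqP => eb.
  (* If [b = 0], this choice of [y] yields [a + 1 <= a]. *)
  have := quad 1 ((a + 1) / (2 * c)); rewrite eb mulr0 addr0 expr1n mul1r mulr1.
  have -> : 2 * ((a + 1) / (2 * c)) * c = a + 1 by field; lra.
  by lra.
have : c ^+ 2 <= a * b.
  (* Taking [x = b] and [y = c] gives the discriminant inequality multiplied by [b]. *)
  rewrite -(ler_pM2l b_gt0); have := quad b c.
  have -> : 2 * b * c * c = 2 * (b * c ^+ 2) by ring.
  have -> : b ^+ 2 * a + c ^+ 2 * b = b * (a * b) + b * c ^+ 2 by ring.
  by lra.
rewrite -ler_sqrt ?mulr_ge0// sqrtr_sqr sqrtrM//.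
exact/le_trans/ler_norm.
Qed.

Lemma l2normD k (u v : 'cV[R]_k) : l2norm (u + v) <= l2norm u + l2norm v.
Proof.
rewrite -(@ler_pXn2r _ 2%N)// ?nnegrE ?addr_ge0 ?l2norm_ge0//.
have E (w : 'cV[R]_k) : l2norm w ^+ 2 = \sum_i w i 0 ^+ 2.
  by rewrite sqr_sqrtr// sumr_ge0// => i _; exact: sqr_ge0.
have -> : l2norm (u + v) ^+ 2 =
    l2norm u ^+ 2 + l2norm v ^+ 2 + 2 * \sum_i u i 0 * v i 0.
  rewrite !E mulr_sumr -!big_split/=; apply: eq_bigr => i _.
  by rewrite mxE; ring.
by have := sum_mul_le_l2norm u v; rewrite sqrrD mulr2n; lra.
Qed.

Lemma l2norm_perturb k (x y x' y' : 'cV[R]_k) :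
  `|l2norm (x - y) - l2norm (x' - y')| <= l2norm (x - x') + l2norm (y - y').
Proof.
have tri (a b c e : 'cV[R]_k) :
    l2norm (a - b) <= l2norm (c - e) + (l2norm (a - c) + l2norm (b - e)).
  have -> : a - b = (c - e) + ((a - c) + (- (b - e))).
    by apply/matrixP => i j; rewrite !mxE; ring.
  rewrite -(l2normN (b - e)); apply: (le_trans (l2normD _ _)).
  by rewrite lerD2l l2normD.
have := tri x y x' y'; have := tri x' y' x y.
rewrite -(l2normN (x' - x)) -(l2normN (y' - y)) !opprB => ? ?.
by rewrite ler_norml; apply/andP; split; lra.
Qed.

(** * Large coordinates of a vector with bounded [s]-norm *)

Lemma exists_subset_card (I : finType) (J : {set I}) (s : nat) :
  (s <= #|J|)%N -> exists2 K : {set I}, K \subset J & #|K| = s.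
Proof.
move=> sJ; exists [set x in take s (enum J)]%SET.
  by apply/fintype.subsetP => x; rewrite inE => /mem_take; rewrite mem_enum.
by rewrite cardsE (card_uniqP _) ?take_uniq ?enum_uniq// size_takel// -cardE.
Qed.

Definition peaks {m} (v : 'cV[R]_m) (r : R) : {set 'I_m} :=
  [set i | r < `|v i 0|]%SET.

Section TopNorm.
Variables (s m : nat) (v : 'cV[R]_m) (r : R).
Hypotheses (s_range : (1 <= s <= m)%N) (r0 : 0 <= r).
Hypothesis top_le : topnorm s v <= Num.sqrt s%:R * r.

Lemma sum_sqr_le_topnorm (K : {set 'I_m}) : #|K| = s ->
  \sum_(i in K) v i 0 ^+ 2 <= s%:R * r ^+ 2.
Proof.
move=> Ks; have : Num.sqrt (\sum_(i in K) v i 0 ^+ 2) <= Num.sqrt s%:R * r.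
  apply: le_trans top_le; rewrite /topnorm (bigD1 K) ?Ks//=.
  by rewrite le_max lexx.
have S0 : 0 <= \sum_(i in K) v i 0 ^+ 2 by apply: sumr_ge0 => i _; exact: sqr_ge0.
rewrite -(@ler_pXn2r _ 2%N)// ?nnegrE ?mulr_ge0 ?sqrtr_ge0//.
by rewrite exprMn !sqr_sqrtr.
Qed.

(** Otherwise some [s] peaks would have squares summing to more than [s r^2]; strictness comes from
    [s >= 1], which makes the chosen set nonempty. *)
Lemma card_peaks_le : (#|peaks v r| <= s)%N.
Proof.
rewrite leqNgt; apply/negP => /ltnW sJ.
have [K KJ Ks] := exists_subset_card sJ.
have := sum_sqr_le_topnorm Ks; apply/negP; rewrite -ltNge.
rewrite -Ks mulr_natl -sumr_const; apply: ltr_sum => [|i /(fintype.subsetP KJ)].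
  have /card_gt0P[x xK] : (0 < #|K|)%N by rewrite Ks; case/andP: s_range.
  by apply/hasP; exists x => //; exact: mem_index_enum.
by rewrite inE -(real_normK (num_real (v i 0))) => ri; rewrite ltrXn2r ?nnegrE.
Qed.

(** The peaks number at most [s <= m], so they can be padded to a set of exactly [s] indices, which
    only increases the sum of squares. *)
Lemma sum_sqr_peaks_le : \sum_(i in peaks v r) v i 0 ^+ 2 <= s%:R * r ^+ 2.
Proof.
have sm : (s - #|peaks v r| <= #|~: peaks v r|)%N.
  by rewrite leq_subLR cardsC card_ord; case/andP: s_range.
have [K KJ Ks] := exists_subset_card sm.
have dis : (peaks v r :&: K)%SET = finset.set0.
  apply/setP => i; rewrite finset.in_setI finset.in_set0; apply/negbTE/andP => -[pi].
  by move=> /(fintype.subsetP KJ); rewrite finset.in_setC pi.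
have UKs : #|(peaks v r :|: K)%SET| = s.
  by rewrite cardsU dis cards0 subn0 Ks subnKC// card_peaks_le.
apply: le_trans (sum_sqr_le_topnorm UKs).
rewrite big_mkcond [leRHS]big_mkcond/=; apply: ler_sum => i _.
by rewrite finset.in_setU; case: (i \in peaks v r) => //=; case: ifP; rewrite ?sqr_ge0.
Qed.

End TopNorm.

End Norms.

(** * Dithers for which the embedding holds *)

Section Hamming.
Context {R : realType} {m : nat}.
Implicit Types (B C : 'I_m -> set R) (t : 'I_m -> R).

Lemma hitsE B t : hits B t = #|[set i | `[< B i (t i) >]]%SET|.
Proof. by rewrite cardsE; apply: eq_card => i; apply: asbool_equiv_eq. Qed.

(** Converts an upper bound on the hits of the complements into a lower bound on hits, so that a
    one-sided tail estimate gives both sides. *)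
Lemma hits_setC B t : (hits B t + hits (fun i => ~` B i) t)%N = m.
Proof.
rewrite !hitsE -[RHS]card_ord -(cardsC [set i | `[< B i (t i) >]]%SET).
congr addn; apply: eq_card => i; rewrite finset.in_setC !inE.
exact: asbool_neg.
Qed.

Lemma hits_leU B C t (J : {set 'I_m}) :
  (forall i, B i (t i) -> (i \in J) \/ C i (t i)) ->
  (hits B t <= #|J| + hits C t)%N.
Proof.
move=> BC; rewrite !hitsE; apply: leq_trans (leq_card_setU _ _).1.
apply/subset_leq_card/fintype.subsetP => i; rewrite finset.in_setU !inE.
move=> Bi; case: (BC i Bi) => [->//|h]; apply/orP; right; exact/asboolP.
Qed.

Lemma hammingE (u v : 'cV[R]_m) :
  hamming u v = #|[set i | u i 0 != v i 0]%SET|.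
Proof. by rewrite cardsE; apply: eq_card => i; exact: asboolb. Qed.

Lemma hammingC (u v : 'cV[R]_m) : hamming u v = hamming v u.
Proof. by rewrite !hammingE; apply: eq_card => i; rewrite !inE eq_sym. Qed.

Lemma hamming_triangle (v u w : 'cV[R]_m) :
  (hamming u w <= hamming u v + hamming v w)%N.
Proof.
rewrite !hammingE; apply: leq_trans (leq_card_setU _ _).1.
apply/subset_leq_card/fintype.subsetP => i; rewrite finset.in_setU !inE.
by have [->|] := eqVneq (u i 0) (v i 0).
Qed.

End Hamming.

(** * Deterministic embedding estimate for a fixed dither *)

Section TypicalDither.
Context {R : realType}.

Definition crossings {m} (a b : 'cV[R]_m) (i : 'I_m) := crossing (a i 0) (b i 0).

Definition windows {m} (a : 'cV[R]_m) (r : R) (i : 'I_m) := window (a i 0) r.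

Lemma hamming_onebit {m n} (A : 'M[R]_(m, n)) (t : 'I_m -> R) x y :
  hamming (onebit A (\col_i t i) x) (onebit A (\col_i t i) y) =
  hits (crossings (A *m x) (A *m y)) t.
Proof.
apply: eq_card => i; apply: asbool_equiv_eq.
by rewrite /= /onebit /crossings /crossing /= !mxE.
Qed.

(** The excess vanishes off the peaks, and on a peak [|x| - l <= x^2 / l] because [|x| > l]; the
    squares over the peaks sum to at most [s l^2]. *)
Lemma sum_excess_le {s m} (v : 'cV[R]_m) (l : R) :
  (1 <= s <= m)%N -> 0 < l -> topnorm s v <= Num.sqrt s%:R * l ->
  \sum_i excess l (v i 0) <= s%:R * l.
Proof.
move=> sm l0 top.
apply: (@le_trans _ _ ((\sum_(i in peaks v l) v i 0 ^+ 2) / l)); last first.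
  rewrite ler_pdivrMr// -mulrA -expr2.
  exact: sum_sqr_peaks_le sm (ltW l0) top.
rewrite mulr_suml [leRHS]big_mkcond/=; apply: ler_sum => i _.
rewrite inE /excess; set x := v i 0.
have xx : x ^+ 2 = `|x| ^+ 2 by rewrite real_normK// num_real.
case: ltP => [lx|lx]; last by rewrite max_r// subr_le0.
by rewrite max_l ?subr_ge0 ?ltW// ltr_pdivlMr// xx; nra.
Qed.

Section Typical.
Variables (n m s : nat) (T : set 'cV[R]_n) (S : {fset 'cV[R]_n}).
Variables (A : 'M[R]_(m, n)) (l delta kappa theta u : R).
Hypotheses (l0 : 0 < l) (delta0 : 0 < delta) (kappa0 : 0 < kappa).
Hypotheses (s_range : (1 <= s <= m)%N) (s_le : s%:R * l <= delta * m%:R).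
Hypotheses (uE : 2 * l * kappa * u = delta).
Hypothesis S_sub : forall x, x \in S -> T x.
Hypothesis S_net : forall x, T x -> exists2 y, y \in S & l2norm (x - y) <= theta.
Hypothesis theta_le : theta <= delta.
Hypothesis l1_isometry : forall x y, x \in S -> y \in S ->
  `|kappa / m%:R * l1norm (A *m (x - y)) - l2norm (x - y)| <= delta.
Hypothesis net_bound : forall x, x \in S ->
  topnorm s (A *m x) <= Num.sqrt s%:R * l.
Hypothesis local_bound : forall x y, T x -> T y -> l2norm (x - y) <= theta ->
  topnorm s (A *m (x - y)) <= Num.sqrt s%:R * delta.
Variable t : 'I_m -> R.

(** The count exceeds its mean under the uniform law by at most [m u]; the failure of this is the
    event that [hoeffding_hits] bounds. *)
Definition few_hits (B : 'I_m -> set R) : Prop :=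
  (hits B t)%:R <= \sum_i fine (uniform_prob (gtrN l0) (B i)) + m%:R * u.

Hypothesis few_crossings : forall x y, x \in S -> y \in S ->
  few_hits (crossings (A *m x) (A *m y)).
Hypothesis few_noncrossings : forall x y, x \in S -> y \in S ->
  few_hits (fun i => ~` crossings (A *m x) (A *m y) i).
Hypothesis few_windows : forall x, x \in S -> few_hits (windows (A *m x) delta).

Let f := onebit A (\col_i t i).
Let c := kappa / m%:R.

Let m0 : 0 < m%:R :> R.
Proof. by rewrite ltr0n; case/andP: s_range => /leq_trans; apply. Qed.

Let c0 : 0 < c. Proof. exact: divr_gt0. Qed.

Let lc0 : 0 < 2 * l * c.
Proof. by apply: mulr_gt0 => //; exact: mulr_gt0. Qed.

Let cm : c * m%:R = kappa. Proof. by rewrite divfK// gt_eqF. Qed.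

Let dtildeE x y : dtilde l kappa (f x) (f y) = 2 * l * c * (hamming (f x) (f y))%:R.
Proof. by rewrite /dtilde /c; congr (_ * _); field; rewrite gt_eqF. Qed.

(** Three errors add up: [delta] for the deviation of the count from its mean, [2 kappa delta] for
    the excesses of the two points, and [delta] for the l1 isometry. *)
Let dtilde_net x y : x \in S -> y \in S ->
  `|dtilde l kappa (f x) (f y) - l2norm (x - y)| <= (2 * kappa + 2) * delta.
Proof.
move=> xS yS; rewrite dtildeE /f hamming_onebit.
set B := crossings _ _; set H := (hits B t)%:R : R.
pose q := \sum_i fine (uniform_prob (gtrN l0) (B i)).
have up : H <= q + m%:R * u by exact: few_crossings.
have lo : q - m%:R * u <= H.
  have := few_noncrossings xS yS; rewrite -/B /few_hits.
  rewrite (eq_bigr (fun i => 1 - fine (uniform_prob (gtrN l0) (B i)))).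
    rewrite sumrB sumr_const card_ord -/q.
    have := congr1 (fun k => k%:R : R) (hits_setC B t); rewrite natrD -/H.
    by lra.
  move=> i _; have mB : measurable (B i) by exact: measurable_crossing.
  exact: (fine_prob_setC (uniform_prob (gtrN l0))).
set N1 := l1norm (A *m (x - y)).
(* Each of the two points contributes a total excess of at most [s l]. *)
have qN : `|2 * l * q - N1| <= 2 * (s%:R * l).
  have -> : 2 * l * q - N1 = \sum_i (2 * l * fine (uniform_prob (gtrN l0) (B i))
      - `|(A *m x) i 0 - (A *m y) i 0|).
    rewrite sumrB -mulr_sumr; congr (_ - _); apply: eq_bigr => i _.
    by rewrite mulmxBr !mxE.
  apply: (le_trans (ler_norm_sum _ _ _)).
  apply: (@le_trans _ _ (\sum_i (excess l ((A *m x) i 0) + excess l ((A *m y) i 0)))).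
    by apply: ler_sum => i _; exact: crossing_prob.
  rewrite big_split/=.
  have := sum_excess_le s_range l0 (net_bound xS).
  have := sum_excess_le s_range l0 (net_bound yS).
  by lra.
have iso := l1_isometry xS yS; rewrite -/c -/N1 in iso.
have -> : 2 * l * c * H - l2norm (x - y) =
    2 * l * c * (H - q) + c * (2 * l * q - N1) + (c * N1 - l2norm (x - y)) by ring.
have Hq : `|2 * l * c * (H - q)| <= delta.
  rewrite normrM gtr0_norm// -uE -cm.
  have -> : 2 * l * (c * m%:R) * u = 2 * l * c * (m%:R * u) by ring.
  by rewrite ler_pM2l// ler_norml; apply/andP; split; lra.
have cq : `|c * (2 * l * q - N1)| <= 2 * kappa * delta.
  rewrite normrM gtr0_norm// -cm.
  have -> : 2 * (c * m%:R) * delta = c * (2 * (delta * m%:R)) by ring.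
  by rewrite ler_pM2l// (le_trans qN)// ler_pM2l.
apply: (le_trans (ler_normD _ _)).
apply: (@le_trans _ _ (delta + 2 * kappa * delta + delta)); last lra.
by rewrite lerD// (le_trans (ler_normD _ _))// lerD.
Qed.

(** At most [s] peaks of the difference cost [2 kappa delta]. At every other coordinate a flip
    forces a window hit; the windows cost [2 kappa delta] in the mean and [delta] in deviation. *)
Let dtilde_local x y : T x -> y \in S -> l2norm (x - y) <= theta ->
  dtilde l kappa (f x) (f y) <= (4 * kappa + 1) * delta.
Proof.
move=> Tx yS xy; rewrite dtildeE /f hamming_onebit.
have Ty := S_sub yS; have top := local_bound Tx Ty xy.
set J := peaks (A *m (x - y)) delta.
have hJ : (#|J| <= s)%N.
  by apply: card_peaks_le top => //; exact: ltW.
have H : (hits (crossings (A *m x) (A *m y)) t <= #|J| + hits (windows (A *m y) delta) t)%N.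
  apply: hits_leU => i; have [iJ|iJ] := boolP (i \in J); first by left.
  move=> cr; right; apply: crossing_window cr _.
  by move: iJ; rewrite inE mulmxBr [_ i 0]mxE [X in _ + X]mxE -leNgt.
have {}H : (hits (crossings (A *m x) (A *m y)) t)%:R <=
    s%:R + (hits (windows (A *m y) delta) t)%:R :> R.
  by rewrite -natrD ler_nat (leq_trans H)// leq_add2r.
have W := few_windows yS; rewrite /few_hits in W.
have Q : l * (\sum_i fine (uniform_prob (gtrN l0) (windows (A *m y) delta i)))
    <= m%:R * delta.
  rewrite mulr_sumr -[m in m%:R]card_ord mulr_natl -sumr_const.
  by apply: ler_sum => i _; apply: window_prob_le; exact: ltW.
have E1 : 2 * l * c * (m%:R * u) = delta by rewrite -uE -cm; ring.
have E2 := ler_wpM2l (ltW lc0) (le_trans H (lerD (lexx _) W)).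
apply: (le_trans E2); rewrite !mulrDr E1.
have E3 : 2 * l * c * s%:R <= 2 * kappa * delta.
  have := ler_wpM2l (ltW c0) s_le; rewrite -cm; lra.
have E4 := ler_wpM2l (ltW c0) Q.
by move: E4; rewrite -cm in E3 *; lra.
Qed.

(** Passing to net points costs [(4 kappa + 1) delta] twice in [dtilde] and [2 theta <= 2 delta] in
    the norm. With the net error the total is [(10 kappa + 6) delta]. *)
Lemma embedding_of_few_hits x y : T x -> T y ->
  `|dtilde l kappa (f x) (f y) - l2norm (x - y)| <= 10 * (kappa + 1) * delta.
Proof.
move=> Tx Ty; have [x' xS xx] := S_net Tx; have [y' yS yy] := S_net Ty.
have N := dtilde_net xS yS.
have Lx := dtilde_local Tx xS xx; have Ly := dtilde_local Ty yS yy.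
have Pt := l2norm_perturb x y x' y'.
have d0 (a b : 'cV[R]_n) : 0 <= dtilde l kappa (f a) (f b).
  by rewrite dtildeE; apply: mulr_ge0 => //; exact: ltW.
have tri (a b e : 'cV[R]_n) : dtilde l kappa (f a) (f e) <=
    dtilde l kappa (f a) (f b) + dtilde l kappa (f b) (f e).
  by rewrite !dtildeE -mulrDr -natrD ler_pM2l// ler_nat hamming_triangle.
have sym (a b : 'cV[R]_n) : dtilde l kappa (f a) (f b) = dtilde l kappa (f b) (f a).
  by rewrite !dtildeE hammingC.
have t1 := tri x x' y; have t2 := tri x' y' y.
have t3 := tri x' x y'; have t4 := tri x y y'.
rewrite (sym y' y) in t2; rewrite (sym x' x) in t3.
have kd : 0 < kappa * delta by exact: mulr_gt0.
move: N Pt; rewrite !ler_norml => /andP[? ?] /andP[? ?].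
by have := theta_le; have := delta0; move=> ? ?; apply/andP; split; lra.
Qed.

End Typical.

End TypicalDither.

(** * Probability of a good dither *)

Section TypicalEvent.
Context {R : realType} {d : measure_display} {Omega : measurableType d}.
Variables (P : probability Omega R) (n m : nat) (l u : R) (l0 : 0 < l).
Variables (S : {fset 'cV[R]_n}) (A : 'M[R]_(m, n)) (delta : R).
Variable tau : 'I_m -> {RV P >-> R}.

(** Windows belong to single points but are indexed by pairs too, so that one union bound over a
    product type covers all three families. *)
Let B (k : 'I_3) (p : S * S) (i : 'I_m) : set R :=
  let C := crossings (A *m val p.1) (A *m val p.2) i in
  match val k with
  | 0%N => C
  | 1%N => ~` C
  | _ => windows (A *m val p.1) delta i
  end.

Let measurable_B k p i : measurable (B k p i).
Proof.
case: k => -[|[|k]] klt; rewrite /B /=.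
- exact: measurable_crossing.
- by apply: measurableC; exact: measurable_crossing.
- exact: measurable_window.
Qed.

Let bad (q : 'I_3 * (S * S)) : set Omega :=
  [set w | \sum_i fine (uniform_prob (gtrN l0) (B q.1 q.2 i)) + m%:R * u
           <= (hits (B q.1 q.2) (tau^~ w))%:R].

Let measurable_bad q : measurable (bad q).
Proof. by apply: measurable_hits_ge => i; exact: measurable_B. Qed.

Definition typical : set Omega := ~` \bigcup_q bad q.

Let bigcup_badE : \bigcup_q bad q = \bigcup_(q in [set` (xpredT : {pred _})]) bad q.
Proof. by congr bigcup; apply/seteqP; split. Qed.

Lemma measurable_typical : measurable typical.
Proof. by apply: measurableC; rewrite bigcup_badE; exact: measurable_bigcup_fin. Qed.

Lemma typicalP w : typical w -> [/\
  forall x y, x \in S -> y \in S ->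
    few_hits u l0 (tau^~ w) (crossings (A *m x) (A *m y)),
  forall x y, x \in S -> y \in S ->
    few_hits u l0 (tau^~ w) (fun i => ~` crossings (A *m x) (A *m y) i) &
  forall x, x \in S -> few_hits u l0 (tau^~ w) (windows (A *m x) delta)].
Proof.
move=> tw; have good q : few_hits u l0 (tau^~ w) (B q.1 q.2).
  rewrite /few_hits leNgt; apply/negP => /ltW h; apply: tw.
  by exists q.
split=> [x y xS yS|x y xS yS|x xS].
- exact: (good (@Ordinal 3 0 isT, ([` xS]%fset, [` yS]%fset))).
- exact: (good (@Ordinal 3 1 isT, ([` xS]%fset, [` yS]%fset))).
- exact: (good (@Ordinal 3 2 isT, ([` xS]%fset, [` xS]%fset))).
Qed.

(** Union bound over three families of [N^2] bad events, [N] being the size of the net, each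
    controlled by [hoeffding_hits]. *)
Lemma typical_prob : uniform_on_cube l0 tau -> 0 <= u ->
  ((1 - 3 * (#|` S|%:R) ^+ 2 * expR (- (m%:R * u ^+ 2 / 8)))%:E <= P typical)%E.
Proof.
move=> unif u0; rewrite /typical bigcup_badE probability_setC; last exact: measurable_bigcup_fin.
set e := expR _.
have bound : (P (\bigcup_(q in [set` (xpredT : {pred _})]) bad q) <=
    (3 * (#|` S|%:R) ^+ 2 * e)%:E)%E.
  apply: (le_trans (prob_bigcup_fin_le P (xpredT : {pred _}) measurable_bad)).
  apply: (@le_trans _ _ (\sum_(q in (xpredT : {pred 'I_3 * (S * S)})) e%:E)%E).
    apply: lee_sum => q _.
    apply: (hoeffding_hits (mu := uniform_prob (gtrN l0))) => //.
  have cardI : #|(xpredT : {pred 'I_3 * (S * S)})| = (3 * (#|` S| * #|` S|))%N.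
    by rewrite -[LHS]/(#|{: 'I_3 * (S * S)}|) !card_prod card_ord cardfE.
  by rewrite sumEFin lee_fin sumr_const cardI -[leLHS]mulr_natl !natrM expr2.
by rewrite EFinB leeB.
Qed.

End TypicalEvent.

(* With z = exp(-h/128) the failure bound is 3 z^2, which is at most 2 z when
   z <= 1/2; otherwise 1 - 2 z is negative. *)
Lemma sub_2expR_le {R : realType} (p h N : R) : 0 <= p -> 0 <= N ->
  N <= expR (h / 128) -> 1 - 3 * N ^+ 2 * expR (- (h / 32)) <= p ->
  1 - 2 * expR (- (h / 128)) <= p.
Proof.
move=> p0 N0 Nle; set z := expR (- (h / 128)) => hp.
have z0 : 0 <= z by exact: expR_ge0.
(* The exponents combine as [h/64 - h/32 = - h/64], which is that of [z^2]. *)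
have : 3 * N ^+ 2 * expR (- (h / 32)) <= 3 * z ^+ 2.
  rewrite -mulrA ler_pM2l//.
  apply: (@le_trans _ _ (expR (h / 128) ^+ 2 * expR (- (h / 32)))).
    by rewrite ler_wpM2r ?expR_ge0// lerXn2r ?nnegrE ?expR_ge0.
  rewrite /z -!expRM_natr -expRD ler_expR; lra.
have [z2|z2] := leP z (1 / 2); last lra.
by have : z ^+ 2 <= z / 2; [rewrite expr2 ler_wpM2l|lra]; lra.
Qed.

Theorem theorem2p1 (R : realType) :
  exists c1 c2 c3 : R, [/\ 0 < c1, 0 < c2 & 0 < c3] /\
  forall (n m : nat) (T : set 'cV[R]_n) (A : 'M[R]_(m, n))
    (lambda delta kappa theta : R)
    (lambda_gt0 : 0 < lambda) (delta_gt0 : 0 < delta) (kappa_gt0 : 0 < kappa)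
    (theta_gt0 : 0 < theta) (theta_le : theta <= delta)
    (Ttheta : {fset 'cV[R]_n}) (Ttheta_net : minimal_net T theta Ttheta)
    (s : nat) (sE : s = Num.truncn (delta * m%:R / lambda))
    (s_range : (1 <= s <= m)%N)
    (m_large : ((c1 * lambda ^+ 2 * kappa ^+ 2)%:E *
                (lne (covering_number T theta) * ((delta ^+ 2)^-1)%:E)
                <= m%:R%:E)%E)
    (l1_isometry :
      (ereal_sup [set (`|kappa / m%:R * l1norm (A *m (x - y)) -
                         l2norm (x - y)|)%:E
                 | x in [set` Ttheta] & y in [set` Ttheta]] <= delta%:E)%E)
    (net_bound :
      (((Num.sqrt s%:R)^-1)%:E *
       ereal_sup [set (topnorm s (A *m x))%:E | x in [set` Ttheta]]
       <= lambda%:E)%E)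
    (local_bound :
      (((Num.sqrt s%:R)^-1)%:E *
       ereal_sup [set (topnorm s (A *m x))%:E
                 | x in diffset T `&` [set theta *: u | u in unit_ball]]
       <= delta%:E)%E)
    (d : measure_display) (Omega : measurableType d)
    (P : probability Omega R) (tau : 'I_m -> {RV P >-> R})
    (tau_unif : uniform_on_cube lambda_gt0 tau),
  with_probability_at_least P
    (1 - 2 * expR (- (c2 * delta ^+ 2 * m%:R / (lambda ^+ 2 * kappa ^+ 2))))
    [set w | let f := onebit A (\col_i tau i w) in
      (ereal_sup [set (`|dtilde lambda kappa (f x) (f y) - l2norm (x - y)|)%:E
                 | x in T & y in T]
       <= (c3 * (kappa + 1) * delta)%:E)%E].
Proof.
(* With [h] as below, [c1 = 128] makes the log of the net size at most [h/128], while each bad event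
   has probability at most [expR (- h/32)]; this leaves [c2 = 1/128]. The 10 is that of
   [embedding_of_few_hits]. *)
exists 128, (1 / 128), 10; split; first by split; lra.
move=> n m T A l delta kappa theta l0 delta0 kappa0 theta0 theta_le S [[S_sub S_net] S_card].
move=> s sE s_range m_large l1_iso net_bound local_bound d Omega P tau unif.
have m0 : 0 < m%:R :> R by rewrite ltr0n; case/andP: s_range => /leq_trans; apply.
have s0 : 0 < s%:R :> R by rewrite ltr0n; case/andP: s_range.
(* A deviation of [m u] in the count amounts to exactly [delta] after the scaling [2 l kappa / m] of
   [dtilde]. *)
pose u := delta / (2 * l * kappa).
have lk0 : 0 < 2 * l * kappa by rewrite !mulr_gt0.
have u0 : 0 <= u by rewrite divr_ge0// ltW.
pose h := delta ^+ 2 * m%:R / (l ^+ 2 * kappa ^+ 2).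
have top_sup k (v : 'cV[R]_k) (r : R) (Z : set (\bar R)) :
    (((Num.sqrt s%:R)^-1)%:E * ereal_sup Z <= r%:E)%E ->
    Z (topnorm s v)%:E -> topnorm s v <= Num.sqrt s%:R * r.
  rewrite lee_pdivrMl ?sqrtr_gt0// -EFinM => Zr Zv; rewrite -lee_fin.
  by apply: le_trans Zr; exact: ereal_sup_ubound.
exists (typical u l0 S A delta tau); split.
- exact: measurable_typical.
- move=> w /typicalP[hi lo win] /=.
  apply: ge_ereal_sup => _ [x Tx [y Ty <-]]; rewrite lee_fin.
  apply: (@embedding_of_few_hits R n m s T S A l delta kappa theta u l0) => //.
  + rewrite sE -ler_pdivlMr// truncn_le// divr_ge0 ?mulr_ge0// ltW//.
  + by rewrite /u mulrC divfK// gt_eqF.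
  + move=> a b aS bS; rewrite -lee_fin; apply: le_trans l1_iso.
    by apply: ereal_sup_ubound; exists a => //; exists b.
  + move=> a aS; apply: (top_sup _ _ _ _ net_bound).
    by exists a.
  + move=> a b Ta Tb ab; apply: (top_sup _ _ _ _ local_bound).
    exists (a - b) => //; split; first by exists a => //; exists b.
    exists (theta^-1 *: (a - b)); last by rewrite scalerA mulfV ?scale1r// gt_eqF.
    rewrite /unit_ball/= l2normZ gtr0_norm ?invr_gt0//.
    by rewrite mulrC ler_pdivrMr// mul1r.
have := typical_prob S A delta unif u0.
have fP : P (typical u l0 S A delta tau) \is a fin_num.
  by apply: fin_num_measure; exact: measurable_typical.
rewrite -(fineK fP) !lee_fin => Pge.
have -> : 1 / 128 * delta ^+ 2 * m%:R / (l ^+ 2 * kappa ^+ 2) = h / 128.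
  by rewrite /h; field; rewrite !gt_eqF.
apply: (@sub_2expR_le R _ h (#|` S|%:R)) => //.
- exact: fine_ge0.
(* An empty net is treated apart, since the passage from [lne] to the real logarithm requires a
   positive cardinality. *)
- have [->|N0] := posnP #|` S|; first exact: expR_ge0.
  have N0' : 0 < #|` S|%:R :> R by rewrite ltr0n.
  rewrite -[leLHS]lnK ?posrE// ler_expR.
  move: m_large; rewrite -S_card lne_EFin// -!EFinM lee_fin => m_large.
  rewrite /h ler_pdivlMr// ler_pdivlMr ?mulr_gt0 ?exprn_gt0//.
  rewrite [leRHS]mulrC -ler_pdivrMr ?exprn_gt0//.
  by apply: le_trans m_large; rewrite le_eqVlt; apply/orP; left; apply/eqP; ring.
- have <- : m%:R * u ^+ 2 / 8 = h / 32 => //.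
  by rewrite /h /u; field; rewrite !gt_eqF.
Qed.
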